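(* Let $\mathcal C$ be a finite set of finite groups, and for each $K\in J_{\mathcal C}$ let $(p_K^n)_{n}$ be a sequence of nonnegative real numbers such that $\lim_{n\to\infty}p_K^n$ exists. Suppose that, for every $H\in J_{\mathcal C}$, $$\sup_n\sum_{K\in J_{\mathcal C}}S_{K,H}\,p_K^n<\infty.$$ Then for every $H\in J_{\mathcal C}$, $$\lim_{n\to\infty}\sum_{K\in J_{\mathcal C}}S_{K,H}\,p_K^n=\sum_{K\in J_{\mathcal C}}S_{K,H}\lim_{n\to\infty}p_K^n.$$
   Context: For a set $\mathcal C$ of finite groups, the level-$\mathcal C$ groups form the smallest set of (isomorphism classes of) finite groups containing $\mathcal C$ and closed under fiber products (equivalently subdirect products) and quotients. $J_{\mathcal C}$ is a set consisting of one group from each isomorphism class of finite level-$\mathcal C$ groups. For groups $K,H$, $S_{K,H}=|\operatorname{Surj}(K,H)|$ is the number of surjective homomorphisms $K\to H$. *)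

(* Defs.v *)
From HB Require Import structures.
From mathcomp Require Import all_boot all_fingroup.

Set Implicit Arguments.
Unset Strict Implicit.
Unset Printing Implicit Defensive.

Local Open Scope group_scope.

Definition fiber_product (A B Q : finGroupType)
    (f : {morphism [set: A] >-> Q}) (g : {morphism [set: B] >-> Q}) :
    {set A * B} :=
  [set x | f x.1 == g x.2].

Lemma fiber_product_group_set (A B Q : finGroupType)
    (f : {morphism [set: A] >-> Q}) (g : {morphism [set: B] >-> Q}) :
  group_set (fiber_product f g).
Proof.
apply/group_setP; split=> [|x y]; rewrite !inE ?morph1 // => /eqP fgx /eqP fgy.
by rewrite !morphM ?inE // fgx fgy.
Qed.

Canonical fiber_product_group (A B Q : finGroupType)
    (f : {morphism [set: A] >-> Q}) (g : {morphism [set: B] >-> Q}) :=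
  Group (fiber_product_group_set f g).

(* A set of finite groups is given by a family C.  The fiber products are those
   of two surjections: by Goursat's lemma these are, up to isomorphism, the
   subdirect products, whereas fiber products of arbitrary morphisms would also
   produce all normal subgroups. *)
Inductive level (I : Type) (C : I -> finGroupType) : finGroupType -> Prop :=
| level_gen (i : I) : level C (C i)
| level_isog (A B : finGroupType) :
    level C A -> [set: A] \isog [set: B] -> level C B
| level_fiber_product (A B Q : finGroupType)
    (f : {morphism [set: A] >-> Q}) (g : {morphism [set: B] >-> Q}) :
    level C A -> level C B ->
    f @* [set: A] = [set: Q] -> g @* [set: B] = [set: Q] ->
    level C (subg_of (fiber_product_group f g))
| level_quotient (A : finGroupType) (N : {group A}) :
    level C A -> N <| [set: A] -> level C (coset_of N).

(* The set J_C is a family G of level-C groups, indexed by J, in which every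
   isomorphism class of level-C groups occurs exactly once. *)
Definition level_representatives (I : Type) (C : I -> finGroupType)
    (J : Type) (G : J -> finGroupType) : Prop :=
  (forall j : J, level C (G j)) /\
  (forall A : finGroupType, level C A ->
     exists! j : J, [set: A] \isog [set: G j]).

Definition surjections (K H : finGroupType) : {set {ffun K -> H}} :=
  [set f : {ffun K -> H} | morphic [set: K] f && (f @: [set: K] == [set: H])].

(* Main.v *)
Require Import Defs.
From HB Require Import structures.
From mathcomp Require Import all_boot all_order all_algebra all_fingroup.
From mathcomp Require Import gseries.

(** The sum and the limit may be exchanged as soon as the tails are uniformly
    small in n, and this follows from a domination of surjection counts: for
    every H there are finitely many H_1, ..., H_r such that
    S_{K,H} <= e * (S_{K,H_1} + ... + S_{K,H_r}) for each e > 0 and all but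
    finitely many K.  The H_i do not depend on e, so the bounds on the sums of
    S_{K,H_i} p_K^n make the tail of the sum of S_{K,H} p_K^n at most a
    constant times e.

    To get the domination, let c be a constant to be chosen, and let N(K) be
    the number of normal subgroups of K of index at most c.  For a surjection
    phi from K to H and such a subgroup X, the quotient of K by the
    intersection of X and ker phi is a group of level C and of order at most
    c * |H|, and phi and X can be recovered from a surjection of K onto this
    quotient up to a number of choices bounded in terms of H.  Hence
    N(K) * S_{K,H} is at most a constant times the sum of S_{K,H'} over the
    finitely many H' of level C and of order at most c * |H|
    (normals_surjections_bounded).

    It remains to see that N(K) tends to infinity, that is, that |K| is bounded
    in terms of N(K) for K of level C (level_few_normals_bounded).  Two
    properties of the members of C survive subdirect products and quotients.
    First, chief factors have order at most m, the largest order of a member of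
    C; then a maximal subgroup M of K has a core of index at most
    c = m! * m (maximal_core_index).  So the intersection R of the normal
    subgroups of index at most c lies in the Frattini subgroup, and K is
    generated by representatives of K / R, which has order at most c ^ N(K).
    Secondly, every law of C holds in K: K lies in the variety generated by
    finitely many finite groups, in which the order of a group is bounded in
    terms of the number of its generators (law_bound_card). *)

Set Implicit Arguments.
Unset Strict Implicit.
Unset Printing Implicit Defensive.

Local Open Scope group_scope.

(** * Subdirect products and quotients *)

Lemma coset_surjection (A : finGroupType) (N : {group A}) :
  N <| [set: A] -> exists f : {morphism [set: A] >-> coset_of N},
    f @* [set: A] = [set: coset_of N] /\ 'ker f = N.
Proof.
move=> nN; have sN : [set: A] \subset 'N(N) by rewrite normal_norm.
exists (restrm_morphism sN (coset_morphism N)); split.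
  apply/eqP; rewrite eqEsubset subsetT; apply/subsetP=> y _.
  have [x Nx ->] := cosetP y.
  by rewrite morphim_restrm setIid; apply: mem_morphim; rewrite ?in_setT.
by rewrite ker_restrm ker_coset setTI.
Qed.

(** A fiber product over a common quotient enters only through its two
    projections, which are surjective because the two maps to that quotient
    are, and whose kernels meet trivially.  Isomorphisms and quotients are both
    surjections. *)
Lemma level_subdirect_ind (I : Type) (C : I -> finGroupType)
    (P : finGroupType -> Prop) :
  (forall i, P (C i)) ->
  (forall (A B : finGroupType) (f : {morphism [set: A] >-> B}),
     f @* [set: A] = [set: B] -> P A -> P B) ->
  (forall (F A B : finGroupType)
      (f : {morphism [set: F] >-> A}) (g : {morphism [set: F] >-> B}),
     f @* [set: F] = [set: A] -> g @* [set: F] = [set: B] ->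
     'ker f :&: 'ker g = 1 -> P A -> P B -> P F) ->
  forall A : finGroupType, level C A -> P A.
Proof.
move=> P_gen P_morphim P_subdirect A.
elim=> {A} [i|A B _ PA /isogP[f _ fT]|A B Q f g _ PA _ PB fT gT|A N _ PA nN].
- exact: P_gen.
- exact: P_morphim _ _ _ fT PA.
- set F := subg_of _.
  have pM : {in [set: F] &, {morph (fun x : F => (sgval x).1) : x y / x * y}}.
    by [].
  have qM : {in [set: F] &, {morph (fun x : F => (sgval x).2) : x y / x * y}}.
    by [].
  have lift (a : A) (b : B) : f a = g b -> exists x : F, sgval x = (a, b).
    move=> fgab; have Fab : (a, b) \in fiber_product_group f g.
      by rewrite inE /= fgab.
    by exists (Subg Fab).
  apply: (P_subdirect _ _ _ (Morphism pM) (Morphism qM)) PA PB.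
  + apply/setP=> a; rewrite in_setT morphimEdom; apply/imsetP.
    have /morphimP[b _ _ fab] : f a \in g @* [set: B] by rewrite gT inE.
    by have [x xab] := lift _ _ fab; exists x; rewrite ?inE //= xab.
  + apply/setP=> b; rewrite in_setT morphimEdom; apply/imsetP.
    have /morphimP[a _ _ gba] : g b \in f @* [set: A] by rewrite fT inE.
    by have [x xab] := lift _ _ (esym gba); exists x; rewrite ?inE //= xab.
  + apply/trivgP/subsetP=> x /setIP[/mker /= x1 /mker /= x2].
    by rewrite inE; apply/eqP/val_inj; rewrite /= [sgval x]surjective_pairing x1 x2.
- by have [f [fT _]] := coset_surjection nN; apply: P_morphim _ _ _ fT PA.
Qed.

(** * Chief factors *)

(** Equivalently, the chief factors of A have order at most m.  Ranging over all
    pairs of normal subgroups, rather than over chief factors, avoids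
    minimality conditions and passes directly to preimages and images. *)
Definition chief_bounded (m : nat) (A : finGroupType) : Prop :=
  forall X Y : {group A}, X <| [set: A] -> Y <| [set: A] -> X \proper Y ->
  exists Z : {group A},
    [/\ Z <| [set: A], X \proper Z, Z \subset Y & #|Z : X| <= m].

Lemma chief_bounded_card m (A : finGroupType) :
  #|A| <= m -> chief_bounded m A.
Proof.
move=> leAm X Y nX nY ltXY; exists Y; split=> //.
apply: leq_trans leAm; rewrite -cardsT (leq_trans (dvdn_leq _ (dvdn_indexg Y X))) //.
by rewrite subset_leq_card ?subsetT.
Qed.

Lemma morphpre_normalT (A B : finGroupType) (f : {morphism [set: A] >-> B})
    (S : {group B}) :
  f @* [set: A] = [set: B] -> S <| [set: B] -> f @*^-1 S <| [set: A].
Proof.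
move=> fT nS; have sT (H : {group B}) : H \subset f @* [set: A].
  by rewrite fT subsetT.
have := morphpre_normal (sT S) (sT [group of [set: B]]).
by rewrite nS /= morphpreT.
Qed.

Lemma chief_bounded_morphim m (A B : finGroupType)
    (f : {morphism [set: A] >-> B}) :
  f @* [set: A] = [set: B] -> chief_bounded m A -> chief_bounded m B.
Proof.
move=> fT bA X Y nX nY ltXY.
have sT (S : {group B}) : S \subset f @* [set: A] by rewrite fT subsetT.
have [|Z [nZ ltXZ sZY iZ]] :=
  bA [group of f @*^-1 X] [group of f @*^-1 Y] 
    (morphpre_normalT fT nX) (morphpre_normalT fT nY).
  by rewrite morphpre_proper.
exists [group of f @* Z]; split.
- by have := morphim_normal f nZ; rewrite fT.
- rewrite properE -{1}(morphpreK (sT X)) morphimS ?(proper_sub ltXZ) //=.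
  by case/andP: ltXZ => _; rewrite sub_morphim_pre ?subsetT.
- by rewrite -(morphpreK (sT Y)) morphimS.
rewrite -(morphpreK (sT X)).
apply: leq_trans iZ; apply: dvdn_leq; first exact: indexg_gt0.
by apply: index_morphim; rewrite subsetT.
Qed.

(** If X and Y have the same intersection with ker f, the images of X and Y in A
    differ, and a subgroup between these images is lifted inside Y without
    enlarging the part in ker f.  Otherwise, as g is injective on ker f, a
    subgroup between the images in B of those intersections lifts to a subgroup
    of ker f, which is multiplied by X. *)
Lemma chief_bounded_subdirect m (F A B : finGroupType)
    (f : {morphism [set: F] >-> A}) (g : {morphism [set: F] >-> B}) :
  f @* [set: F] = [set: A] -> g @* [set: F] = [set: B] ->
  'ker f :&: 'ker g = 1 ->
  chief_bounded m A -> chief_bounded m B -> chief_bounded m F.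
Proof.
move=> fT gT kfg bA bB X Y nX nY ltXY; have sXY := proper_sub ltXY.
have nkf : 'ker f <| [set: F] := ker_normal f.
have [eqk|neqk] := eqVneq (X :&: 'ker f) (Y :&: 'ker f).
  have [|||Z [nZ ltZ sZ iZ]] := bA [group of f @* X] [group of f @* Y].
  - by have := morphim_normal f nX; rewrite fT.
  - by have := morphim_normal f nY; rewrite fT.
  - rewrite properE morphimS //=; apply/negP=> sfYX; case/andP: ltXY => _ /negP[].
    apply/subsetP=> y Yy.
    have /morphimP[x _ Xx fyx] : f y \in f @* X.
      exact: (subsetP sfYX) _ (mem_morphim f (in_setT y) Yy).
    have Xk : x^-1 * y \in X :&: 'ker f.
      rewrite eqk; apply/setIP; split.
        by rewrite groupM // groupV (subsetP sXY).
      by apply/kerP; rewrite ?inE // morphM ?inE // morphV ?inE // fyx mulVg.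
    by rewrite -(mulKVg x y) groupM //; case/setIP: Xk.
  have fZ : f @* (Y :&: f @*^-1 Z) = Z by rewrite morphim_setIpre; apply/setIidPr.
  have sXZ : X \subset Y :&: f @*^-1 Z.
    by rewrite subsetI sXY -sub_morphim_pre ?subsetT // proper_sub.
  exists [group of Y :&: f @*^-1 Z]; split.
  - apply: normalI => //; exact: morphpre_normalT.
  - rewrite properE sXZ /=; apply/negP=> sZX; case/andP: ltZ => _ /negP[].
    by rewrite -fZ morphimS.
  - exact: subsetIl.
  - have /= <- := index_morphim_ker f sXZ (subsetT _).
    have -> : #|'ker_(Y :&: f @*^-1 Z) f : X| = 1%N.
      apply/eqP; rewrite indexg_eq1.
      by apply: (subset_trans (setSI _ (subsetIl _ _))); rewrite -eqk subsetIl.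
    by rewrite muln1 fZ.
set X0 := X :&: 'ker f; set Y0 := Y :&: 'ker f.
have sX0 : X0 \subset Y0 by rewrite setSI.
have nX0 : X0 <| [set: F] by apply: normalI.
have nY0 : Y0 <| [set: F] by apply: normalI.
have kg (S : {set F}) : S \subset 'ker f -> 'ker_S g \subset [1].
  by move=> sS; rewrite -kfg setSI.
have [|||Z [nZ ltZ sZ iZ]] := bB [group of g @* X0] [group of g @* Y0].
- by have := morphim_normal g nX0; rewrite gT.
- by have := morphim_normal g nY0; rewrite gT.
- rewrite properE morphimS //=; apply/negP=> sgYX; case/negP: neqk.
  rewrite eqEsubset sX0; apply/subsetP=> y Yy.
  have /morphimP[x _ Xx gyx] : g y \in g @* X0.
    exact: (subsetP sgYX) _ (mem_morphim g (in_setT y) Yy).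
  suff: x^-1 * y \in [1] by move/set1P=> xy1; rewrite -(mulKVg x y) xy1 mulg1.
  have [Xx1 kx] := setIP Xx; have [Yy1 ky] := setIP Yy.
  rewrite -kfg; apply/setIP; split; first by rewrite groupM ?groupV.
  by apply/kerP; rewrite ?inE // morphM ?inE // morphV ?inE // gyx mulVg.
set Z0 := Y0 :&: g @*^-1 Z.
have gZ : g @* Z0 = Z by rewrite morphim_setIpre; apply/setIidPr.
have sXZ : X0 \subset Z0.
  by rewrite subsetI sX0 -sub_morphim_pre ?subsetT // proper_sub.
have nZ0 : Z0 <| [set: F].
  apply: normalI => //; exact: morphpre_normalT.
have sZk : Z0 \subset 'ker f by rewrite (subset_trans (subsetIl _ _)) ?subsetIr.
have iZ0 : #|Z0 : X0| = #|Z : g @* X0|.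
  have /= <- := index_morphim_ker g sXZ (subsetT _).
  have -> : #|'ker_Z0 g : X0| = 1%N.
    by apply/eqP; rewrite indexg_eq1 (subset_trans (kg _ sZk)) ?sub1G.
  by rewrite muln1 gZ.
have XZ0 : Z0 :&: X = X0.
  apply/eqP; rewrite eqEsubset [X0 \subset _]subsetI sXZ subsetIl andbT.
  by rewrite subsetI subsetIr (subset_trans (subsetIl _ _)).
have nXZ0 : Z0 \subset 'N(X) by rewrite (subset_trans (subsetT _)) ?normal_norm.
exists [group of X <*> Z0]; split.
- exact: normalY.
- rewrite properE joing_subl join_subG subxx /=; apply/negP=> sZX.
  case/andP: ltZ => _ /negP[]; rewrite -gZ morphimS //.
  by rewrite /X0 subsetI sZX.
- by rewrite join_subG sXY (subset_trans (subsetIl _ _)) ?subsetIl.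
by rewrite /= norm_joinEr // indexMg -indexgI XZ0 iZ0.
Qed.

Lemma level_chief_bounded (I : finType) (C : I -> finGroupType) A :
  level C A -> chief_bounded (\max_i #|C i|) A.
Proof.
elim/level_subdirect_ind=> {A} [i|A B f|F A B f g].
- by apply: chief_bounded_card; apply: (leq_bigmax i).
- exact: chief_bounded_morphim.
- exact: chief_bounded_subdirect.
Qed.

(** Conjugation embeds the quotient by the centralizer in the permutations
    of N. *)
Lemma index_cent_normal (gT : finGroupType) (N : {group gT}) :
  N <| [set: gT] -> #|[set: gT] : 'C(N)| <= #|N|`!.
Proof.
move=> nN; have sN : [set: gT] \subset 'N(N) by rewrite normal_norm.
rewrite -ker_conj_aut -[X in #|X : _|](setIidPr sN) -card_morphim -card_perm.
apply: leq_trans (subset_leq_card (Aut_conj_aut _ _)) _.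
by apply/subset_leq_card/subsetP=> s; rewrite inE => /andP[].
Qed.

(** Let Z be a normal subgroup with 1 < Z and |Z| <= m.  It is not contained in
    M, whose core is trivial, so K = Z M.  The intersection of C(Z) and M is
    normalized by M and centralized by Z, hence normal in K, hence trivial.  So
    |C(Z)| |M| <= |K| <= |Z| |M|, which gives |C(Z)| <= m, while C(Z) has index
    at most m!. *)
Lemma primitive_card m (K : finGroupType) (M : {group K}) :
  chief_bounded m K -> maximal M [set: K] -> gcore M [set: K] = 1 ->
  #|[set: K]| <= m`! * m.
Proof.
move=> bK maxM M1; have ltMT := maxgroupp maxM.
have [|||Z [nZ ltZ _]] := bK 1%G [group of [set: K]].
- exact: normal1.
- exact: normal_refl.
- by rewrite (sub_proper_trans _ ltMT) ?sub1G.
rewrite indexg1 => Zm.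
have nZM : M \subset 'N(Z) by rewrite (subset_trans (subsetT _)) ?normal_norm.
have ZM : Z * M = [set: K].
  rewrite -norm_joinEr //.
  have [sZM|//] : Z \subset M \/ Z <*> M = [set: K].
    have [_ max] := maxgroupP maxM.
    have [eqT|neT] := eqVneq (Z <*> M) [set: K]; [by right|left].
    rewrite -(max [group of Z <*> M]) ?joing_subl ?joing_subr //=.
    by rewrite properE subsetT /= subTset.
  case/idPn: ltZ; rewrite proper1G negbK -subG1 -M1.
  by apply: gcore_max => //; apply: normal_norm.
have nC : 'C(Z) <| [set: K].
  by rewrite /normal subsetT norms_cent ?normal_norm.
have CM1 : 'C(Z) :&: M = 1.
  have nCM : [set: K] \subset 'N('C(Z) :&: M).
    rewrite -ZM mul_subG //; first by rewrite cents_norm // centsC subsetIl.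
    by rewrite normsI ?normG // (subset_trans (subsetT _)) ?normal_norm.
  by apply/trivgP; rewrite -M1 gcore_max // subsetIr.
have Cm : #|'C(Z)| <= m.
  apply: leq_trans Zm; rewrite -(leq_pmul2r (cardG_gt0 M)).
  have /= <- := TI_cardMg CM1; rewrite mul_cardG ZM.
  by rewrite (leq_trans _ (leq_pmulr _ _)) ?cardG_gt0 // subset_leq_card ?subsetT.
rewrite -(Lagrange (subsetT 'C(Z))) mulnC leq_mul //.
exact: leq_trans (index_cent_normal nZ) (leq_fact Zm).
Qed.

Lemma maximal_core_index m (K : finGroupType) (M : {group K}) :
  chief_bounded m K -> maximal M [set: K] ->
  #|[set: K] : gcore M [set: K]| <= m`! * m.
Proof.
move=> bK maxM; set X := [group of gcore M [set: K]].
have nX : X <| [set: K] by apply: gcore_normal; apply: subsetT.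
have sXM : X \subset M by apply: gcore_sub.
have [f [fT kf]] := coset_surjection nX.
have sT (H : {group coset_of X}) : H \subset f @* [set: K] by rewrite fT subsetT.
have preM : f @*^-1 (f @* M) = M.
  by rewrite morphimGK ?subsetT // kf.
have -> : #|[set: K] : gcore M [set: K]| = #|[set: coset_of X]|.
  by rewrite -fT card_morphim setIid kf.
apply: (@primitive_card _ _ [group of f @* M]).
- exact: chief_bounded_morphim fT bK.
- have /= := morphpre_maximal (f := f) (sT [group of f @* M]) (sT [group of [set: coset_of X]]).
  by rewrite preM morphpreT => <-.
have nD : gcore (f @* M) [set: coset_of X] <| [set: coset_of X].
  by apply: gcore_normal; apply: subsetT.
have := morphpre_normalT (S := [group of gcore (f @* M) [set: coset_of X]]) fT nD.
set D := [group of gcore _ _] => nfD.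
have sDX : f @*^-1 D \subset X.
  apply: gcore_max; last exact: normal_norm nfD.
  by rewrite -preM morphpreS // gcore_sub.
apply/trivgP; rewrite -(morphpreK (sT D)).
by rewrite -(morphim_ker f) kf morphimS.
Qed.

(** * Bounding a group by its normal subgroups of small index *)

Definition normals_of_index (b : nat) (K : finGroupType) : {set {group K}} :=
  [set X : {group K} | (X <| [set: K]) && (#|[set: K] : X| <= b)].

Lemma index_setI_leq (gT : finGroupType) (H L : {group gT}) :
  #|[set: gT] : H :&: L| <= #|[set: gT] : H| * #|[set: gT] : L|.
Proof.
rewrite -(Lagrange_index (subsetT H) (subsetIl H L)) leq_mul // indexgI.
by apply: subset_leq_card; apply: imsetS; apply: subsetT.
Qed.

Lemma index_bigcap_leq (b : nat) (K : finGroupType) (S : {set {group K}}) :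
  (forall X : {group K}, X \in S -> #|[set: K] : X| <= b) ->
  #|[set: K] : \bigcap_(X in S) X| <= b ^ #|S|.
Proof.
move=> bS; rewrite cardE -big_enum /=.
have: {subset enum S <= S} by move=> X; rewrite mem_enum.
suff capH (s : seq {group K}) : {subset s <= S} ->
    exists2 H : {group K}, \bigcap_(X <- s) (X : {set K}) = H
      & #|[set: K] : H| <= b ^ size s.
  by move=> /capH[H -> ?].
elim: s => [|X s IHs] sS.
  by exists [group of [set: K]]; rewrite ?big_nil ?indexgg.
have [|H Hcap bH] := IHs; first by move=> Y sY; rewrite sS // inE sY orbT.
exists [group of X :&: H]; first by rewrite big_cons Hcap.
rewrite expnS (leq_trans (index_setI_leq _ _)) // leq_mul //.
by rewrite bS // sS // mem_head.
Qed.

(** The intersection R of the normal subgroups of index at most b is contained in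
    all maximal subgroups, so no maximal subgroup contains a set of
    representatives of the cosets of R. *)
Lemma few_normals_generators (b : nat) (K : finGroupType) :
  (forall M : {group K}, maximal M [set: K] ->
     #|[set: K] : gcore M [set: K]| <= b) ->
  exists2 T : {set K}, #|T| <= b ^ #|normals_of_index b K| & <<T>> = [set: K].
Proof.
move=> core_b; set S := normals_of_index b K.
set R := \bigcap_(X in S) (X : {set K}).
exists [set repr Y | Y in rcosets R [set: K]].
  apply: leq_trans (leq_imset_card _ _) _; apply: index_bigcap_leq => X.
  by rewrite inE => /andP[].
set T := [set _ | _ in _].
have [//|[M maxM]] := maximal_exists (subsetT <<T>>).
rewrite gen_subG => sTM; case/andP: (maxgroupp maxM) => _ /negP[].
have sRM : R \subset M.
  apply: subset_trans (gcore_sub M [set: K]).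
  apply: (bigcap_inf [group of gcore M [set: K]]).
  by rewrite inE /= gcore_normal ?subsetT // core_b.
apply/subsetP=> x _.
have : repr (R :* x) \in M.
  by apply: (subsetP sTM); apply/imset_f/rcosetsP; exists x; rewrite ?inE.
have /rcosetP[r Rr ->] := mem_repr_rcoset [group of R] x.
by rewrite groupMl // (subsetP sRM).
Qed.

(** Positive words suffice: in a finite group inverses are powers. *)
Definition word_value (d : nat) (gT : finGroupType) (k : 'I_d -> gT)
  (w : seq 'I_d) : gT := \prod_(i <- w) k i.

Lemma word_value_morph d (A B : finGroupType) (f : {morphism [set: A] >-> B})
    (k : 'I_d -> A) w :
  f (word_value k w) = word_value (f \o k) w.
Proof.
elim: w => [|i w IHw]; rewrite /word_value ?big_nil ?morph1 //.
by rewrite !big_cons morphM ?inE // [f (\prod_(_ <- w) _)]IHw.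
Qed.

Lemma eq_word_value d (A : finGroupType) (k k' : 'I_d -> A) :
  k =1 k' -> word_value k =1 word_value k'.
Proof. by move=> kk' w; apply: eq_bigr. Qed.

Definition satisfies_laws_of (I : Type) (C : I -> finGroupType)
    (A : finGroupType) : Prop :=
  forall (d : nat) (u v : seq 'I_d),
    (forall i (c : 'I_d -> C i), word_value c u = word_value c v) ->
  forall k : 'I_d -> A, word_value k u = word_value k v.

(** The easy half of Birkhoff's theorem: laws pass to quotients and to subdirect
    products. *)
Lemma level_laws (I : Type) (C : I -> finGroupType) A :
  level C A -> satisfies_laws_of C A.
Proof.
elim/level_subdirect_ind=> {A} [i|A B f fT lA|F A B f g _ _ kfg lA lB] d u v luv k.
- exact: luv.
- have liftk i : exists a, f a = k i.
    by have /morphimP[a _ _ ->] : k i \in f @* [set: A]; [rewrite fT inE|exists a].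
  have [k' fk'] := fin_all_exists liftk.
  by rewrite -!(eq_word_value fk') -!word_value_morph (lA _ _ _ luv).
- suff: (word_value k v)^-1 * word_value k u \in 'ker f :&: 'ker g.
    by rewrite kfg => /set1P/(canRL (mulKVg _)); rewrite mulg1.
  rewrite inE; apply/andP; split; apply/kerP; rewrite ?inE //;
  by rewrite morphM ?inE // morphV ?inE // !word_value_morph ?(lA _ _ _ luv) ?(lB _ _ _ luv) mulVg.
Qed.

Definition law_bound (I : finType) (C : I -> finGroupType) (d : nat) : nat :=
  #|{ffun {i : I & {ffun 'I_d -> C i}} -> {i : I & C i}}|.

(** A word in the generators is determined, as an element of A, by the values
    that it takes on all d-tuples of elements of the groups C i; law_bound
    counts the functions that could arise in this way. *)
Lemma law_bound_card (I : finType) (C : I -> finGroupType) (A : finGroupType)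
    (d : nat) (T : {set A}) :
  satisfies_laws_of C A -> #|T| <= d -> <<T>> = [set: A] ->
  #|A| <= law_bound C d.
Proof.
move=> lawA Td genT.
pose k (i : 'I_d) : A := nth 1 (enum T) i.
have word x : exists w, word_value k w = x.
  have /gen_prodgP[n [c Tc ->]] : x \in <<T>> by rewrite genT inE.
  have cT i : exists j, k j = c i.
    have ltd : index (c i) (enum T) < d.
      by rewrite (leq_trans _ Td) // cardE index_mem mem_enum.
    by exists (Ordinal ltd); rewrite /k /= nth_index ?mem_enum.
  have [j kj] := fin_all_exists cT.
  exists [seq j i | i <- index_enum 'I_n]; rewrite /word_value big_map.
  by apply: eq_bigr => i _; rewrite kj.
have [w kw] := fin_all_exists word.
pose h (x : A) : {ffun {i : I & {ffun 'I_d -> C i}} -> {i : I & C i}} :=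
  [ffun s : {i : I & {ffun 'I_d -> C i}} =>
     Tagged C (word_value (tagged s) (w x))].
apply: (leq_card h) => x y /ffunP hxy; rewrite -(kw x) -(kw y).
apply: lawA => i c.
have := hxy (Tagged (fun i => {ffun 'I_d -> C i}) [ffun j => c j]).
rewrite !ffunE => /eqP; rewrite eq_Tagged /= => /eqP.
have cE : [ffun j => c j] =1 c by move=> j; rewrite ffunE.
by rewrite !(eq_word_value cE).
Qed.

(** The bound of maximal_core_index for groups of level C. *)
Definition core_bound (I : finType) (C : I -> finGroupType) : nat :=
  let m := \max_i #|C i| in m`! * m.

(** The bound on the index does not depend on n: this is what makes the finite
    list of groups in normals_surjections_bounded the same for all e in the
    domination of surjection counts. *)
Lemma level_few_normals_bounded (I : finType) (C : I -> finGroupType) (n : nat) :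
  exists b, forall K : finGroupType, level C K ->
    #|normals_of_index (core_bound C) K| <= n -> #|K| <= b.
Proof.
set c := core_bound C.
(* The base c.+1, rather than c, makes the power monotone in the exponent. *)
exists (law_bound C (c.+1 ^ n)) => K levK Kn.
have [T Tc genT] :
    exists2 T : {set K}, #|T| <= c ^ #|normals_of_index c K| & <<T>> = [set: K].
  apply: few_normals_generators => M; apply: maximal_core_index.
  exact: level_chief_bounded.
apply: (law_bound_card (level_laws levK)) genT.
apply: leq_trans Tc (leq_trans _ (leq_pexp2l (ltn0Sn c) Kn)).
by case: #|_| => // k; rewrite leq_exp2r.
Qed.

(** * Counting surjections *)

(** The multiplication of A, transported along e: a set of triples in a type that
    does not depend on A, so that different groups can be compared. *)
Definition mul_graph (b : nat) (A : finGroupType) (e : A -> 'I_b) :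
    {set 'I_b * 'I_b * 'I_b} :=
  [set (e x.1, e x.2, e (x.1 * x.2)) | x : A * A].

Lemma mul_graph_isog b (A B : finGroupType) (e : A -> 'I_b) (f : B -> 'I_b) :
  injective e -> injective f -> mul_graph e = mul_graph f ->
  [set: A] \isog [set: B].
Proof.
move=> e_inj f_inj ef.
have graphT (D : finGroupType) (d : D -> 'I_b) (x y : D) :
    (d x, d y, d (x * y)) \in mul_graph d.
  by apply/imsetP; exists (x, y).
have ex_h x : exists y, f y = e x.
  have := graphT _ e x 1; rewrite ef => /imsetP[[y z] _ [-> _ _]].
  by exists y.
have [h fh] := fin_all_exists ex_h.
have hM : {in [set: A] &, {morph h : x y / x * y}}.
  move=> x y _ _; apply/f_inj; rewrite fh.
  have := graphT _ e x y; rewrite ef => /imsetP[[u v] _ [exu eyv ->]] /=.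
  by congr (f (_ * _)); apply/f_inj; rewrite fh.
apply/isogP; exists (Morphism hM).
  by apply/injmP=> x y _ _ /= hxy; apply/e_inj; rewrite -!fh hxy.
apply/setP=> y; rewrite in_setT morphimEdom; apply/imsetP.
have := graphT _ f y 1; rewrite -ef => /imsetP[[x z] _ [fy _ _]].
by exists x; rewrite ?inE //=; apply/f_inj; rewrite fh.
Qed.

Lemma card_cover (T : finType) (J : eqType) (s : seq J) (P : {set T})
    (Q : J -> {set T}) :
  (forall x, x \in P -> exists2 j, j \in s & x \in Q j) ->
  #|P| <= \sum_(j <- s) #|Q j|.
Proof.
move=> PQ; apply: (@leq_trans #|\bigcup_(j <- s) Q j|).
  apply/subset_leq_card/subsetP=> x /PQ[j sj Qx].
  by rewrite (big_rem j sj) /= inE Qx.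
elim: s {PQ} => [|j s IHs]; first by rewrite !big_nil cards0.
by rewrite !big_cons (leq_trans (leq_card_setU _ _)) // leq_add2l.
Qed.

Lemma surjectionsP (K H : finGroupType) (phi : {ffun K -> H}) :
  reflect (exists2 f : {morphism [set: K] >-> H},
             f @* [set: K] = [set: H] & phi =1 f)
          (phi \in surjections K H).
Proof.
rewrite inE; apply: (iffP andP) => [[phiM /eqP phiT]|[f fT phif]].
  exists (morphm_morphism phiM) => //.
  by rewrite morphimEdom.
split; first by apply/morphicP=> x y Kx Ky; rewrite !phif morphM.
by rewrite -fT morphimEdom; apply/eqP/eq_imset.
Qed.

Lemma level_representatives_inj (I : Type) (C : I -> finGroupType) (J : Type)
    (G : J -> finGroupType) :
  level_representatives C G ->
  forall i j, [set: G i] \isog [set: G j] -> i = j.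
Proof.
move=> [levG GP] i j Gij; have [k [_ kP]] := GP _ (levG i).
by rewrite -(kP i (isog_refl _)) -(kP j Gij).
Qed.

Lemma exists_level_quotient (I : Type) (C : I -> finGroupType) (J : Type)
    (G : J -> finGroupType) (K : finGroupType) (N : {group K}) :
  level_representatives C G -> level C K -> N <| [set: K] ->
  exists j, exists2 f : {morphism [set: K] >-> G j},
    f @* [set: K] = [set: G j] & 'ker f = N.
Proof.
move=> GJ levK nN; have [q [qT kq]] := coset_surjection nN.
have [j [/isogP[g /trivgP gI gT] _]] := GJ.2 _ (level_quotient levK nN).
exists j.
have fM : {in [set: K] &, {morph g \o q : x y / x * y}}.
  by move=> x y _ _; rewrite /= !morphM ?inE.
exists (Morphism fM).
  apply/setP=> y; rewrite in_setT morphimEdom; apply/imsetP.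
  have /morphimP[z _ _ ->] : y \in g @* [set: coset_of N] by rewrite gT inE.
  have /morphimP[x _ _ ->] : z \in q @* [set: K] by rewrite qT inE.
  by exists x; rewrite ?inE.
apply: etrans kq; apply/setP=> x.
apply/idP/idP=> /mker /= qx; apply/kerP; rewrite ?inE //=.
  have : q x \in 'ker g by apply/kerP; rewrite ?inE.
  by rewrite gI => /set1P.
by rewrite qx morph1.
Qed.

(** The quotient g of K by the intersection of X with the kernel of phi lands in
    one of the representatives G j, of order at most b * |H|.  The pair (X, phi)
    is recovered from g, the subset g(X) of G j and the function from G j to H
    through which phi factors. *)
Lemma normals_surjections_leq (I : Type) (C : I -> finGroupType) (J : eqType)
    (G : J -> finGroupType) (b : nat) (H K : finGroupType) (s : seq J) :
  level_representatives C G -> level C K ->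
  (forall j, #|G j| <= b * #|H| -> j \in s) ->
  #|normals_of_index b K| * #|surjections K H| <=
  \sum_(j <- s) #|surjections K (G j)| * (#|{ffun G j -> H}| * #|{set G j}|).
Proof.
move=> GJ levK sP.
pose lift j (t : {ffun K -> G j} * ({ffun G j -> H} * {set G j})) :=
  (t.1 @^-1: t.2.2, [ffun x => t.2.1 (t.1 x)] : {ffun K -> H}).
pose P := setX ((fun X : {group K} => X : {set K}) @: normals_of_index b K) (surjections K H).
have -> : (#|normals_of_index b K| * #|surjections K H|)%N = #|P|.
  by rewrite cardsX card_imset //; apply: val_inj.
pose Q j := lift j @: setX (surjections K (G j)) setT.
apply: leq_trans (_ : _ <= \sum_(j <- s) #|Q j|) _; last first.
  apply: leq_sum => j _; apply: leq_trans (leq_imset_card _ _) _.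
  by rewrite cardsX cardsT card_prod.
apply: card_cover => -[_ phi] /setXP[/imsetP[X X_b ->] /surjectionsP[f fT phif]].
move: X_b; rewrite inE => /andP[nX Xb].
have nN : X :&: 'ker f <| [set: K] by apply: normalI (ker_normal f).
have [j [g gT kg]] := exists_level_quotient GJ levK nN.
exists j.
  apply: sP; rewrite -cardsT -gT card_morphim setIid kg.
  apply: leq_trans (index_setI_leq _ _) _; rewrite leq_mul //.
  have := card_morphim f [set: K]; rewrite setIid fT cardsT => <-.
  exact: max_card.
have ex_a y : exists z, forall x, g x = y -> phi x = z.
  have /morphimP[x0 _ _ ->] : y \in g @* [set: K] by rewrite gT inE.
  exists (phi x0) => x gx; rewrite !phif.
  have : x0^-1 * x \in 'ker g.
    by apply/kerP; rewrite ?inE // morphM ?inE // morphV ?inE // gx mulVg.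
  rewrite kg => /setIP[_ /mker]; rewrite morphM ?inE // morphV ?inE //.
  by move/(canRL (mulKVg _)); rewrite mulg1.
have [a aP] := fin_all_exists ex_a.
apply/imsetP; exists ([ffun x => g x], ([ffun y => a y], g @: X)).
  apply/setXP; split; last by rewrite inE.
  by apply/surjectionsP; exists g => // x; rewrite ffunE.
congr pair; last by apply/ffunP=> x; rewrite !ffunE; apply: aP.
apply/setP=> x; rewrite !inE /= ffunE; apply/idP/imsetP => [Xx|[y Xy gxy]].
  by exists x.
have : y^-1 * x \in 'ker g.
  by apply/kerP; rewrite ?inE // morphM ?inE // morphV ?inE // gxy mulVg.
by rewrite kg => /setIP[]; rewrite groupMl ?groupV.
Qed.

Local Close Scope group_scope.

From mathcomp Require Import finmap.
From mathcomp Require Import all_classical all_reals all_analysis.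

Import Order.TTheory GRing.Theory Num.Theory.
Import numFieldNormedType.Exports.

Local Open Scope classical_set_scope.
Local Open Scope ring_scope.
Local Open Scope ereal_scope.

(** The multiplication tables of the groups of order at most b form a finite set,
    and equal tables come from isomorphic groups. *)
Lemma finite_bounded_order (I : Type) (C : I -> finGroupType) (J : choiceType)
    (G : J -> finGroupType) (b : nat) :
  level_representatives C G ->
  finite_set [set j | (#|G j| <= b)%N].
Proof.
move=> /level_representatives_inj G_inj.
pose e (j : J) (x : G j) : 'I_b.+1 := inord (enum_rank x).
have e_inj j : (#|G j| <= b)%N -> injective (@e j).
  move=> jb x y /(congr1 val) /=.
  by rewrite !inordK ?(leq_trans (ltn_ord _)) ?leqW // => /val_inj/enum_rank_inj.
have graph_inj : {in [set j | (#|G j| <= b)%N] &,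
    injective (fun j => mul_graph (@e j))}.
  move=> i j /set_mem /= ib /set_mem /= jb eij.
  exact/G_inj/(mul_graph_isog (e_inj _ ib) (e_inj _ jb) eij).
have /card_eqPle[_ le_graph] := inj_card_eq graph_inj.
exact: card_le_finite le_graph finite_finset.
Qed.

Lemma normals_surjections_bounded (I : finType) (C : I -> finGroupType)
    (J : choiceType) (G : J -> finGroupType) (H : J) :
  level_representatives C G ->
  exists (s : seq J) (D : nat), forall K : J,
   (#|normals_of_index (core_bound C) (G K)| * #|surjections (G K) (G H)| <=
     D * \sum_(j <- s) #|surjections (G K) (G j)|)%N.
Proof.
move=> GJ; set b := core_bound C.
have := finite_bounded_order (b * #|G H|) GJ.
move=> /finite_seqP[s sE]; exists s.
exists (\sum_(j <- s) #|{ffun G j -> G H}| * #|{set G j}|)%N => K.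
apply: leq_trans (normals_surjections_leq (s := s) GJ (b := b) _ _) _.
- exact: GJ.1.
- by move=> j jb; have : [set` s] j by rewrite -sE.
rewrite big_distrr /= big_seq [leqRHS]big_seq; apply: leq_sum => j js.
by rewrite mulnC leq_mul // (big_rem j js) leq_addr.
Qed.

(** * Limits of sums with uniformly small tails *)

Lemma esum_finite_part_tail (R : realType) (J : choiceType) (a : J -> R)
    (F : set J) (e : R) :
  (forall j, (0 <= a j)%R) -> finite_set F ->
  \esum_(j in ~` F) (a j)%:E <= e%:E ->
  exists2 t : R, (0 <= t <= e)%R &
    \esum_(j in [set: J]) (a j)%:E = (\sum_(j <- fset_set F) a j + t)%:E.
Proof.
move=> a0 finF tail.
have tail0 : 0 <= \esum_(j in ~` F) (a j)%:E.
  by apply: esum_ge0 => j _; rewrite lee_fin.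
have tailfin : \esum_(j in ~` F) (a j)%:E \is a fin_num.
  by rewrite ge0_fin_numE // (le_lt_trans tail) // ltry.
exists (fine (\esum_(j in ~` F) (a j)%:E)).
  by rewrite fine_ge0 //= -lee_fin fineK.
rewrite (esumID F) => [|j _]; last by rewrite lee_fin.
rewrite !setTI EFinD fineK //; congr (_ + _).
have := esum_fset finF (a := fun j => (a j)%:E).
move=> -> => [|j _]; last by rewrite lee_fin.
by rewrite fsbig_finite //= sumEFin.
Qed.

(** The limit l has the same tail bounds as the a n, by passage to the limit in
    finite partial sums.  So the two sums differ by at most e / 2 plus the
    difference of finite sums, which tends to 0. *)
Lemma cvg_esum_uniform_tail (R : realType) (J : choiceType)
    (a : nat -> J -> R) (l : J -> R) :
  (forall n j, (0 <= a n j)%R) ->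
  (forall j, (fun n => a n j) @ \oo --> l j) ->
  (forall e : R, (0 < e)%R -> exists2 F : set J, finite_set F &
     forall n, \esum_(j in ~` F) (a n j)%:E <= e%:E) ->
  (fun n => \esum_(j in [set: J]) (a n j)%:E) @ \oo -->
  \esum_(j in [set: J]) (l j)%:E.
Proof.
move=> a0 al tails.
have l0 j : (0 <= l j)%R.
  by apply: (cvgr_to_ge (al j)); exact: nearW.
have cvg_sum (s : seq J) :
    (fun n => \sum_(j <- s) a n j)%R @ \oo --> (\sum_(j <- s) l j)%R.
  by apply: cvg_big => [|j _]; [exact: add_continuous|exact: al].
have ltails e F : finite_set F -> (forall n, \esum_(j in ~` F) (a n j)%:E <= e%:E) ->
    \esum_(j in ~` F) (l j)%:E <= e%:E.
  move=> finF aF; apply: ge_ereal_sup => _ [X [finX XF] <-].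
  rewrite fsbig_finite //= sumEFin lee_fin.
  apply: (cvgr_to_le (cvg_sum (fset_set X))).
  apply: nearW => n; rewrite -lee_fin; apply: le_trans (aF n).
  by apply: esum_ge; exists X; rewrite // fsbig_finite //= sumEFin.
have [F1 finF1 tF1] := tails 1%R ltr01.
have Sfin n : \esum_(j in [set: J]) (a n j)%:E \is a fin_num.
  by have [t _ ->] := esum_finite_part_tail (a0 n) finF1 (tF1 n).
have Tfin : \esum_(j in [set: J]) (l j)%:E \is a fin_num.
  by have [t _ ->] := esum_finite_part_tail l0 finF1 (ltails _ _ finF1 tF1).
rewrite -(fineK Tfin); apply/fine_cvgP; split; first exact: nearW.
apply/cvgrPdist_le => e e0.
have e2 : (0 < e / 2)%R by rewrite divr_gt0.
have [F finF tF] := tails _ e2.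
have [t /andP[t0 te] ->] := esum_finite_part_tail l0 finF (ltails _ _ finF tF).
have /cvgrPdist_le/(_ _ e2) := cvg_sum (fset_set F).
apply: filterS => n ne /=.
have [u /andP[u0 ue] ->] := esum_finite_part_tail (a0 n) finF (tF n).
rewrite /= opprD addrACA [leRHS]splitr; apply: le_trans (ler_normD _ _) _.
apply: lerD => //; rewrite ler_norml; apply/andP; split.
  by rewrite lerBrDr (le_trans _ t0) // addrC subr_le0.
by rewrite lerBlDr (le_trans te) // lerDl.
Qed.

Theorem theorem6p1 (R : realType) (I : finType) (C : I -> finGroupType)
    (J : choiceType) (G : J -> finGroupType)
    (GJ : level_representatives C G)
    (p : J -> nat -> R)
    (p_ge0 : forall (K : J) (n : nat), (0 <= p K n)%R)
    (p_cvg : forall K : J, cvgn (p K))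
    (p_sup : forall H : J,
       ereal_sup (range (fun n : nat =>
         \esum_(K in [set: J]) (#|surjections (G K) (G H)|%:R * p K n)%:E))
       < +oo) :
  forall H : J,
    (fun n : nat =>
       \esum_(K in [set: J]) (#|surjections (G K) (G H)|%:R * p K n)%:E)
      @ \oo -->
    \esum_(K in [set: J]) (#|surjections (G K) (G H)|%:R * limn (p K))%:E.
Proof.
move=> H.
have [s [D sD]] := normals_surjections_bounded H GJ.
pose S K j : R := #|surjections (G K) (G j)|%:R.
have bounded j : exists M : R, forall n (X : {fset J}),
    (\sum_(K <- X) S K j * p K n <= M)%R.
  have [M supM] : exists M : R, ereal_sup (range (fun n : nat =>
      \esum_(K in [set: J]) (S K j * p K n)%:E)) <= M%:E.
    move: (p_sup j); case: ereal_sup => [M|//|] _; first by exists M.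
    by exists 0%R; rewrite leNye.
  exists M => n X; rewrite -lee_fin; apply: le_trans supM.
  apply: le_trans (ereal_sup_ubound _); last by exists n.
  by apply: esum_ge; exists [set` X] => //; rewrite -fsbig_seq ?fset_uniq // sumEFin.
have [M M_bound] := choice bounded.
have M0 j : (0 <= M j)%R by have := M_bound j 0%N fset0; rewrite big_seq_fset0.
apply: cvg_esum_uniform_tail => [n K|K|e e0].
- by rewrite mulr_ge0.
- by apply: cvgMl_tmp; exact: p_cvg.
pose A : R := (D%:R * \sum_(j <- s) M j)%R.
have A0 : (0 <= A)%R by rewrite mulr_ge0 // sumr_ge0.
(* Off the set F below the tail is at most A / N, and N is large enough for
     this to be at most e. *)
pose N := (Num.truncn (A / e)).+1.
have AN : (A <= N%:R * e)%R.
  by rewrite -ler_pdivrMr // ltW // truncnS_gt.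
pose F := [set K : J | (#|normals_of_index (core_bound C) (G K)| <= N)%N].
exists F.
  have [b bP] := level_few_normals_bounded C N.
  apply: sub_finite_set (finite_bounded_order b GJ).
  by move=> K /= /bP; apply; exact: GJ.1.
move=> n; apply: ge_ereal_sup => _ [X [finX XF] <-].
rewrite fsbig_finite //= sumEFin lee_fin.
have N0 : (0 < N%:R :> R)%R by rewrite ltr0n.
rewrite -(ler_pM2l N0); apply: le_trans AN.
rewrite mulr_sumr.
apply: (@le_trans _ _ (\sum_(K <- fset_set X) D%:R * \sum_(j <- s) S K j * p K n)%R).
  rewrite big_seq [leRHS]big_seq; apply: ler_sum => K.
  rewrite in_fset_set // inE => /XF /negP; rewrite -ltnNge => NK.
  rewrite mulrA -mulr_suml mulrA ler_wpM2r // -natr_sum -!natrM ler_nat.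
  by apply: leq_trans (sD K); rewrite leq_mul // ltnW.
rewrite -mulr_sumr exchange_big /= ler_wpM2l //; apply: ler_sum => j _.
exact: M_bound.
Qed.
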